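(* Let $WC$ be the 0/1 encoding of a constraint $C$ as a weighted constraint with costs $c^{01}$ over extended domains, such that every pair of $B$ belongs to at least one support of $C$ over the extended domains (ignoring costs). Let $\mathcal{F}\subseteq B$ be the set of inconsistent pairs, i.e. the pairs that do not belong to any support of $C$ over the original domains. Then there exists an optimal dual solution $\tilde{u}$ of $(D)$ for $WC$ with costs $c^{01}$ such that for every pair $ij\in B$: $$ij\in\mathcal{F}\iff r_{ij}(\tilde{u})>0.$$
   Context: Setting. $C$ is a constraint on variables $X_1,\dots,X_n$, i.e. a set of allowed tuples of integers. Each variable has a finite original domain $D(X_i)\subset\mathbb{Z}$ and a finite extended domain $D'(X_i)\supseteq D(X_i)$, obtained by adding values. $B=\{ij : 1\le i\le n,\ j\in D'(X_i)\}$ is the set of variable/value pairs over the extended domains, where $ij$ is short for $(i,j)$. A support of $C$ over the original (resp. extended) domains is a tuple $\langle a_1,\dots,a_n\rangle$ allowed by $C$ with $a_i\in D(X_i)$ (resp. $a_i\in D'(X_i)$) for all $i$. A pair $ij$ belongs to a tuple if $a_i=j$. 0/1 encoding: $WC$ is the weighted constraint $C(X_1,\dots,X_n)\wedge\sum_{i=1}^n c^{01}_{i,X_i}\le Z$ over the extended domains, with cost variable $Z$ equal to $0$ and costs $c^{01}_{ij}=0$ if $j\in D(X_i)$ and $c^{01}_{ij}=1$ if $j\in D'(X_i)\setminus D(X_i)$. Thus a pair belongs to a support of $C$ over the original domains iff it belongs to a support over the extended domains of total cost $0$. $\mathcal{S}\subseteq\{0,1\}^{B}$ is the set of characteristic vectors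 ($x_{ij}=1$ iff $a_i=j$) of the supports of $C$ over the extended domains. An ideal formulation is assumed available: $A$ is a real $m\times|B|$ matrix with columns $A_{ij}$ and $b\in\mathbb{R}^m$, with $\{x\in\mathbb{R}^{B}_+ : Ax\ge b\}=\mathrm{conv}(\mathcal{S})$. The primal $(P)$ is $\min\{c^{01}x : Ax\ge b,\ x\in\mathbb{R}^B_+\}$ and its dual $(D)$ is $\max\{ub : uA\le c^{01},\ u\in\mathbb{R}^m_+\}$. The reduced cost of a pair $ij$ for a feasible dual solution $u$ is $r_{ij}(u)=c^{01}_{ij}-uA_{ij}$.
   Formalization: The formal theorem additionally assumes that C has at least one support over the original domains (i.e. WC has a support of cost 0); without this the statement fails, e.g. for D(X_1)=D(X_2)={0}, D'={0,1}, C={(0,1),(1,0)}. *)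

(* Defs.v *)
From mathcomp Require Import all_boot all_order all_algebra finmap.
From mathcomp Require Import boolp classical_sets reals.

Set Implicit Arguments.
Unset Strict Implicit.
Unset Printing Implicit Defensive.

Import Order.TTheory GRing.Theory Num.Theory.

Local Open Scope classical_set_scope.
Local Open Scope ring_scope.

(** ** Constraints, supports, and the 0/1 encoding *)

(* A constraint on X_1, ..., X_n is the set C : set (n.-tuple int) of its
   allowed tuples; domains are a family E : 'I_n -> {fset int}. *)

Definition supports (n : nat) (C : set (n.-tuple int))
    (E : 'I_n -> {fset int}) : set (n.-tuple int) :=
  [set a | C a /\ forall i, tnth a i \in E i].

(* The variable/value pairs over the domains E: the pair ij is p with
   pvar p = i and pval p = j. *)
Definition pairs (n : nat) (E : 'I_n -> {fset int}) : finType :=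
  {i : 'I_n & E i}.

Definition pvar (n : nat) (E : 'I_n -> {fset int}) (p : pairs E) : 'I_n :=
  tag p.

Definition pval (n : nat) (E : 'I_n -> {fset int}) (p : pairs E) : int :=
  val (tagged p).

Definition belongs (n : nat) (E : 'I_n -> {fset int}) (p : pairs E)
    (a : n.-tuple int) : bool :=
  tnth a (pvar p) == pval p.

(* The supports of the weighted constraint
   C(X_1, ..., X_n) /\ \sum_i c_(i, X_i) <= Z over the domains E. *)
Definition weighted_supports (R : realType) (n : nat) (C : set (n.-tuple int))
    (E : 'I_n -> {fset int}) (c : 'I_n -> int -> R) (Z : R) :
    set (n.-tuple int) :=
  [set a | supports C E a /\ \sum_(i < n) c i (tnth a i) <= Z].

(* The extended domains are not an argument: c01 is only evaluated at values j of
   the extended domain of X_i. *)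
Definition c01 (R : realType) (n : nat) (D : 'I_n -> {fset int})
    (i : 'I_n) (j : int) : R :=
  if j \in D i then 0 else 1.

Definition inconsistent (n : nat) (C : set (n.-tuple int))
    (D D' : 'I_n -> {fset int}) : set (pairs D') :=
  [set p | ~ exists2 a, supports C D a & belongs p a].

(** ** Linear programs

    Vectors over B = pairs E have their coordinates indexed by 'I_#|B|, the
    pair p having index enum_rank p. *)

Definition le_mx (R : realType) (m n : nat) (M N : 'M[R]_(m, n)) : Prop :=
  forall i j, M i j <= N i j.

Definition convex_hull (R : realType) (n : nat) (S : set 'cV[R]_n) :
    set 'cV[R]_n :=
  [set x | exists (k : nat) (v : 'I_k -> 'cV[R]_n) (w : 'I_k -> R),
     [/\ forall i, S (v i), forall i, 0 <= w i, \sum_(i < k) w i = 1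
       & x = \sum_(i < k) w i *: v i]].

Definition char_vector (R : realType) (n : nat) (E : 'I_n -> {fset int})
    (a : n.-tuple int) : 'cV[R]_#|pairs E| :=
  \col_k (belongs (enum_val k) a)%:R.

Arguments char_vector R {n} E a.

Definition char_vectors (R : realType) (n : nat) (C : set (n.-tuple int))
    (E : 'I_n -> {fset int}) : set 'cV[R]_#|pairs E| :=
  [set char_vector R E a | a in supports C E].

Arguments char_vectors R {n} C E _.

Definition cost_vector (R : realType) (n : nat) (E : 'I_n -> {fset int})
    (c : 'I_n -> int -> R) : 'rV[R]_#|pairs E| :=
  \row_k c (pvar (enum_val k)) (pval (enum_val k)).

(* Feasible set of the primal min {c x : A x >= b, x >= 0}. *)
Definition primal_feasible (R : realType) (m n : nat) (A : 'M[R]_(m, n))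
    (b : 'cV[R]_m) : set 'cV[R]_n :=
  [set x | le_mx b (A *m x) /\ le_mx 0 x].

(* Feasible set of the dual max {u b : u A <= c, u >= 0}. *)
Definition dual_feasible (R : realType) (m n : nat) (A : 'M[R]_(m, n))
    (c : 'rV[R]_n) : set 'rV[R]_m :=
  [set u | le_mx (u *m A) c /\ le_mx 0 u].

Definition dual_optimal (R : realType) (m n : nat) (A : 'M[R]_(m, n))
    (b : 'cV[R]_m) (c : 'rV[R]_n) : set 'rV[R]_m :=
  [set u | dual_feasible A c u /\
     forall u', dual_feasible A c u' -> le_mx (u' *m b) (u *m b)].

Definition ideal_formulation (R : realType) (n : nat) (C : set (n.-tuple int))
    (E : 'I_n -> {fset int}) (m : nat) (A : 'M[R]_(m, #|pairs E|))
    (b : 'cV[R]_m) : Prop :=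
  primal_feasible A b = convex_hull (char_vectors R C E).

Definition reduced_cost (R : realType) (n : nat) (E : 'I_n -> {fset int})
    (c : 'I_n -> int -> R) (m : nat) (A : 'M[R]_(m, #|pairs E|))
    (u : 'rV[R]_m) (p : pairs E) : R :=
  c (pvar p) (pval p) - (u *m col (enum_rank p) A) 0 0.

(* Main.v *)
Require Import Defs.
From mathcomp Require Import all_boot all_order all_algebra finmap.
From mathcomp Require Import boolp classical_sets reals.
From mathcomp Require Import lra.

Set Implicit Arguments.
Unset Strict Implicit.
Unset Printing Implicit Defensive.

Import Order.TTheory GRing.Theory Num.Theory.

Local Open Scope classical_set_scope.
Local Open Scope ring_scope.

(** A support through an inconsistent pair has cost at least 1, so for small
    eps > 0 the cost c' = c - eps * 1_F is still nonnegative on conv(S), the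
    primal feasible set.  Farkas' lemma turns this into u >= 0 with u A <= c' and
    u b >= 0: this u is dual feasible, it is optimal because the optimal value is
    0, and its reduced costs on F are at least eps.  Off F, complementary
    slackness with a zero-cost support through the pair makes the reduced cost
    vanish. *)

(* Bartl's induction on the number of rows: if the rows of A' alone do not imply
   c >= 0, pick x violating this, scaled so that a x = -1; adding multiples of a
   makes every functional vanish at x, which disposes of the row a. *)
Lemma farkas (R : realType) (k n : nat) (A : 'M[R]_(k, n)) (c : 'rV[R]_n) :
    (forall x : 'cV[R]_n, le_mx 0 (A *m x) -> le_mx 0 (c *m x)) ->
  exists2 u : 'rV[R]_k, le_mx 0 u & c = u *m A.
Proof.
elim: k A c => [|k IHk] A c Ac.
  exists 0 => [i j|]; first by rewrite mxE.
  rewrite mul0mx; apply/rowP => j.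
  (* With no rows the premise is vacuous, so [c] is nonnegative even at plus and minus each unit
     vector, hence zero. *)
  have c_ge0 (x : 'cV[R]_n) : 0 <= (c *m x) 0 0.
    by have := Ac x _ 0 0; rewrite mxE; apply => -[].
  have := c_ge0 (- delta_mx j 0); have := c_ge0 (delta_mx j 0).
  rewrite mulmxN -colE !mxE => c1 c2; lra.
rewrite -[k.+1]/(1 + k)%N in A Ac *.
rewrite -[A]vsubmxK in Ac *; move: (usubmx A) (dsubmx A) Ac => a A' Ac.
have [A'c|/existsNP[x0 /not_implyP[A'x0 /existsNP[i /existsNP[j]]]]] :=
    EM (forall x : 'cV[R]_n, le_mx 0 (A' *m x) -> le_mx 0 (c *m x)).
  have [u u_ge0 ->] := IHk _ _ A'c.
  exists (row_mx 0 u); last by rewrite mul_row_col mul0mx add0r.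
  move=> i j; rewrite [leRHS]mxE [leLHS]mxE.
  case: split => l; first by rewrite mxE.
  by have := u_ge0 i l; rewrite mxE.
rewrite !ord1 [X in X <= _]mxE => /negP; rewrite -ltNge => cx0.
have ax0 : (a *m x0) 0 0 < 0.
  rewrite ltNge; apply/negP => ax0.
  suff /Ac/(_ 0 0) : le_mx 0 (col_mx a A' *m x0) by rewrite mxE leNgt cx0.
  move=> l1 l2; rewrite mul_col_mx [leRHS]mxE !ord1 mxE.
  by case: split => l; rewrite ?ord1 //; have := A'x0 l 0; rewrite mxE.
pose x : 'cV[R]_n := (- (a *m x0) 0 0)^-1 *: x0.
have s_gt0 : 0 < (- (a *m x0) 0 0)^-1 by rewrite invr_gt0 oppr_gt0.
have ax : a *m x = - 1%:M.
  apply/matrixP => l1 l2; rewrite !ord1 -scalemxAr [LHS]mxE [RHS]mxE.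
  by rewrite [in RHS]mxE invrN mulNr mulVf ?(lt_eqF ax0).
have A'x : le_mx 0 (A' *m x).
  move=> l1 l2; rewrite -scalemxAr [leLHS]mxE [leRHS]mxE mulr_ge0 ?(ltW s_gt0)//.
  by have := A'x0 l1 l2; rewrite mxE.
have cx : (c *m x) 0 0 <= 0.
  by rewrite -scalemxAr mxE pmulr_rle0// ltW.
(* At [y], the new functionals take the values of the old ones at [y + (a y) x], where [a] vanishes
   because [a x = -1]; so [Ac] applies to that point. *)
have [y|u u_ge0 cE] := IHk (A' + A' *m x *m a) (c + c *m x *m a).
  rewrite !mulmxDl -!mulmxA -!mulmxDr => A'y.
  apply: Ac; rewrite mul_col_mx mulmxDr mulmxA ax mulNmx mul1mx subrr.
  move=> l1 l2; rewrite [leRHS]mxE mxE; case: split => l; rewrite ?mxE//.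
  by have := A'y l l2; rewrite !mxE.
(* Solving [cE] for [c] gives this multiplier of [a]; it is nonnegative since [A' x >= 0] and
   [c x <= 0]. *)
exists (row_mx (u *m A' *m x - c *m x) u).
  move=> l1 l2; rewrite [leRHS]mxE [leLHS]mxE.
  case: split => l; last by have := u_ge0 l1 l; rewrite mxE.
  rewrite !ord1 [leRHS]mxE [X in _ + X]mxE subr_ge0 (le_trans cx)//.
  rewrite -mulmxA [leRHS]mxE sumr_ge0// => l' _.
  by rewrite mulr_ge0//; [have := u_ge0 0 l'|have := A'x l' 0]; rewrite mxE.
rewrite mul_row_col mulmxBl; move: cE; rewrite mulmxDr !mulmxA => cE.
by rewrite addrAC [_ + u *m A']addrC -cE addrK.
Qed.

Lemma le_mx_mul2l (R : realType) (k m n : nat) (u : 'M[R]_(k, m))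
    (M N : 'M[R]_(m, n)) : le_mx 0 u -> le_mx M N -> le_mx (u *m M) (u *m N).
Proof.
move=> u_ge0 MN i j; rewrite !mxE; apply: ler_sum => l _.
by rewrite ler_wpM2l//; have := u_ge0 i l; rewrite mxE.
Qed.

Lemma le_mx_mul2r (R : realType) (k m n : nat) (x : 'M[R]_(n, k))
    (M N : 'M[R]_(m, n)) : le_mx 0 x -> le_mx M N -> le_mx (M *m x) (N *m x).
Proof.
move=> x_ge0 MN i j; rewrite !mxE; apply: ler_sum => l _.
by rewrite ler_wpM2r//; have := x_ge0 l j; rewrite mxE.
Qed.

Lemma le_mx_trans (R : realType) (m n : nat) (M N P : 'M[R]_(m, n)) :
  le_mx M N -> le_mx N P -> le_mx M P.
Proof. by move=> MN NP i j; apply: le_trans (NP i j). Qed.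

Lemma weak_duality (R : realType) (m n : nat) (A : 'M[R]_(m, n))
    (b : 'cV[R]_m) (c u : 'rV[R]__) x :
  dual_feasible A c u -> primal_feasible A b x -> le_mx (u *m b) (c *m x).
Proof.
move=> [uA u_ge0] [Ax x_ge0]; apply: (@le_mx_trans _ _ _ _ (u *m A *m x)).
  by rewrite -mulmxA; exact: le_mx_mul2l.
exact: le_mx_mul2r.
Qed.

(* Farkas on the homogenization A x >= t b, x >= 0, t >= 0 (the column vector
   (x, t)); a point with t = 0 is a recession direction of the feasible set. *)
Lemma affine_farkas (R : realType) (m n : nat) (A : 'M[R]_(m, n))
    (b : 'cV[R]_m) (d : 'rV[R]_n) :
    primal_feasible A b !=set0 ->
    (forall x, primal_feasible A b x -> le_mx 0 (d *m x)) ->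
  exists2 u : 'rV[R]_m, dual_feasible A d u & le_mx 0 (u *m b).
Proof.
move=> [x0 [Ax0 x0_ge0]] d_ge0.
pose M : 'M[R]_(m + (n + 1), n + 1) := col_mx (row_mx A (- b)) 1%:M.
have [z|w w_ge0] := @farkas _ _ _ M (row_mx d 0).
  rewrite -[z]vsubmxK; move: (usubmx z) (dsubmx z) => x t {z}.
  rewrite mul_col_mx !mul_row_col mul1mx mul0mx addr0 mulNmx => Mz.
  have Axt i : t 0 0 * b i 0 <= (A *m x) i 0.
    have := Mz (lshift _ i) 0; rewrite col_mxEu !mxE big_ord1.
    by rewrite subr_ge0 mulrC.
  have x_ge0 i : 0 <= x i 0.
    by have := Mz (rshift _ (lshift _ i)) 0; rewrite col_mxEd col_mxEu mxE.
  have t_ge0 : 0 <= t 0 0.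
    by have := Mz (rshift _ (rshift _ 0)) 0; rewrite !col_mxEd mxE.
  move=> l1 l2; rewrite !ord1 [leLHS]mxE.
  have [t_gt0|t_le0] := ltP 0 (t 0 0).
    have P : primal_feasible A b ((t 0 0)^-1 *: x).
      split=> i j; rewrite !ord1.
        by rewrite -scalemxAr [leRHS]mxE mulrC ler_pdivlMr// mulrC.
      by rewrite !mxE mulr_ge0// invr_ge0.
    have := d_ge0 _ P 0 0.
    by rewrite -scalemxAr [leLHS]mxE [leRHS]mxE pmulr_rge0// invr_gt0.
  have t0 : t 0 0 = 0 by apply/eqP; rewrite eq_le t_le0 t_ge0.
  have dray s : 0 <= s -> 0 <= (d *m x0) 0 0 + s * (d *m x) 0 0.
    move=> s_ge0; have P : primal_feasible A b (x0 + s *: x).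
      split=> i j; rewrite !ord1.
        rewrite mulmxDr -scalemxAr [leRHS]mxE [X in _ + X]mxE.
        rewrite -[leLHS]addr0 lerD// mulr_ge0//.
        by have := Axt i; rewrite t0 mul0r.
      rewrite !mxE addr_ge0 ?mulr_ge0//.
      by have := x0_ge0 i 0; rewrite mxE.
    have := d_ge0 _ P 0 0; rewrite mulmxDr -scalemxAr.
    by rewrite [leLHS]mxE [leRHS]mxE [X in _ + X]mxE.
  rewrite leNgt; apply/negP => dx.
  have e_ge0 : 0 <= (d *m x0) 0 0 by have := dray 0 (lexx _); rewrite mul0r addr0.
  (* This step length along the ray [x] brings the value of [d] down to exactly -1. *)
  have s_ge0 : 0 <= ((d *m x0) 0 0 + 1) / - (d *m x) 0 0.
    by rewrite divr_ge0 ?addr_ge0// oppr_ge0 ltW.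
  by have := dray _ s_ge0; rewrite invrN mulrN mulNr mulfVK ?(lt_eqF dx)//; lra.
(* The multipliers [v] of the sign constraints are slacks: [d - u A] for [x >= 0] and [u b] for
   [t >= 0]. *)
rewrite -[w]hsubmxK in w_ge0 *; move: (lsubmx w) (rsubmx w) w_ge0 => u v.
move=> uv_ge0; rewrite mul_row_col mulmx1 mul_mx_row -[v]hsubmxK add_row_mx.
have u_ge0 : le_mx 0 u.
  by move=> i j; have := uv_ge0 i (lshift _ j); rewrite row_mxEl !mxE.
have v_ge0 : le_mx 0 v.
  by move=> i j; have := uv_ge0 i (rshift _ j); rewrite row_mxEr !mxE.
move=> /eq_row_mx[dE ubE]; exists u; [split=> // i j|move=> i j].
  rewrite dE [leRHS]mxE lerDl; have := v_ge0 i (lshift _ j).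
  by rewrite [lsubmx v i j]mxE mxE.
have := v_ge0 i (rshift _ j).
have -> : u *m b = rsubmx v.
  by apply/esym/eqP; rewrite -subr_eq0 addrC -mulmxN -ubE.
by rewrite [rsubmx v i j]mxE !mxE.
Qed.

Section ZeroOneEncoding.

Variables (R : realType) (n : nat) (C : set (n.-tuple int)).
Variables (D D' : 'I_n -> {fset int}).

Local Notation cost a :=
  ((cost_vector D' (c01 R D) *m char_vector R D' a) 0 0).

Lemma c01_ge0 i j : 0 <= c01 R D i j.
Proof. by rewrite /c01; case: ifP. Qed.

Lemma mul_char_vector (d : 'rV[R]_#|pairs D'|) a :
  (d *m char_vector R D' a) 0 0 =
  \sum_(p : pairs D' | belongs p a) d 0 (enum_rank p).
Proof.
rewrite mxE [RHS]big_mkcond (reindex (@enum_rank (pairs D'))) /=; last first.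
  by apply: onW_bij; exact: enum_rank_bij.
apply: eq_bigr => p _; rewrite !mxE enum_rankK.
by case: ifP; rewrite ?mulr1 ?mulr0.
Qed.

Lemma char_vector_cost a :
  cost a = \sum_(p : pairs D' | belongs p a) c01 R D (pvar p) (pval p).
Proof.
by rewrite mul_char_vector; apply: eq_bigr => p _; rewrite mxE enum_rankK.
Qed.

Lemma support_cost0 a : supports C D a -> cost a = 0.
Proof.
move=> [_ Da]; rewrite char_vector_cost big1// => p /eqP <-.
by rewrite /c01 Da.
Qed.

(** Some entry leaves its original domain; its pair alone costs 1, and no other cost is negative. *)
Lemma support_cost_ge1 a : supports C D' a -> ~ supports C D a -> 1 <= cost a.
Proof.
move=> [Ca D'a] NDa; have [i Dai] : exists i, tnth a i \notin D i.
  by apply: contrapT => /forallNP Da; apply: NDa; split=> // i; apply/negPn/negP.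
pose p : pairs D' := Tagged D' (FSetSub (D'a i)).
rewrite char_vector_cost (bigD1 p) /=; last by rewrite /belongs /p.
rewrite [X in X + _]/c01 /= (negPf Dai) lerDl sumr_ge0// => q _.
exact: c01_ge0.
Qed.

Lemma weighted_supports0 a :
  weighted_supports C D' (c01 R D) 0 a -> supports C D a.
Proof.
move=> [[Ca _] sum_le0]; split=> // i; apply: contraT => Dai.
suff : 1 <= \sum_(j < n) c01 R D j (tnth a j).
  by move=> /le_trans/(_ sum_le0); rewrite ler10.
rewrite (bigD1 i)//= {1}/c01 (negPf Dai) lerDl sumr_ge0// => j _.
exact: c01_ge0.
Qed.

Lemma supports_extend :
  (forall i, (D i `<=` D' i)%fset) -> supports C D `<=` supports C D'.
Proof. by move=> DD' a [Ca Da]; split=> // i; apply: (fsubsetP (DD' i)). Qed.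

End ZeroOneEncoding.

Lemma convex_hull_ge0 (R : realType) (n : nat) (S : set 'cV[R]_n)
    (d : 'rV[R]_n) :
  (forall x, S x -> le_mx 0 (d *m x)) ->
  forall x, convex_hull S x -> le_mx 0 (d *m x).
Proof.
move=> dS x [k [v [w [Sv w_ge0 _ ->]]]] i j.
rewrite mulmx_sumr summxE [leLHS]mxE sumr_ge0// => l _.
rewrite -scalemxAr [leRHS]mxE mulr_ge0//.
by have := dS _ (Sv l) i j; rewrite mxE.
Qed.

Lemma sub_convex_hull (R : realType) (n : nat) (S : set 'cV[R]_n) :
  S `<=` convex_hull S.
Proof.
move=> x Sx; exists 1%N, (fun=> x), (fun=> 1).
by split=> //; rewrite big_ord1 ?scale1r.
Qed.

Theorem mainTheorem6 (R : realType) (n : nat) (C : set (n.-tuple int))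
    (D D' : 'I_n -> {fset int})
    (m : nat) (A : 'M[R]_(m, #|pairs D'|)) (b : 'cV[R]_m)
    (D_sub_D' : forall i, (D i `<=` D' i)%fset)
    (A_b_ideal : ideal_formulation C A b)
    (pairs_supported :
       forall p : pairs D', exists2 a, supports C D' a & belongs p a)
    (WC_satisfiable : exists a, weighted_supports C D' (c01 R D) 0 a) :
  exists2 u : 'rV[R]_m, dual_optimal A b (cost_vector D' (c01 R D)) u &
    forall p : pairs D',
      inconsistent C D p <-> 0 < reduced_cost (c01 R D) A u p.
Proof.
have feasible a : supports C D' a -> primal_feasible A b (char_vector R D' a).
  by move=> D'a; rewrite A_b_ideal; apply: sub_convex_hull; exists a.
have DD' := @supports_extend _ C _ _ D_sub_D'.
(* The zero-cost support [a0] makes the primal feasible and bounds the dual value above by 0. *)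
have [a0 /weighted_supports0 Da0] := WC_satisfiable.
pose c : 'rV[R]_#|pairs D'| := cost_vector D' (c01 R D).
(* A support contains at most |B| pairs, so lowering the cost of each by [eps] saves at most 1 in
   total. The successor keeps [eps] positive when B is empty. *)
pose eps : R := #|pairs D'|.+1%:R^-1.
have eps_gt0 : 0 < eps by rewrite invr_gt0 ltr0n.
pose f : 'rV[R]_#|pairs D'| :=
  \row_k (eps *+ `[< inconsistent C D (enum_val k) >]).
have f_ge0 k : 0 <= f 0 k by rewrite mxE mulrn_wge0// ltW.
have cf_ge0 x : primal_feasible A b x -> le_mx 0 ((c - f) *m x).
  rewrite A_b_ideal; apply: convex_hull_ge0 => {}x [a D'a <-] i j.
  rewrite !ord1 mulmxBl [leRHS]mxE [X in _ + X]mxE [leLHS]mxE subr_ge0.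
  (* A support over the original domains meets no inconsistent pair, so it gets no discount; any
     other one costs at least 1, which covers its discount. *)
  have [Da|NDa] := EM (supports C D a).
    rewrite (support_cost0 R D' Da) mul_char_vector big1// => p pa.
    by rewrite mxE enum_rankK asboolF// => -[]; exists a.
  apply: le_trans (support_cost_ge1 R D'a NDa).
  rewrite mul_char_vector.
  apply: (@le_trans _ _ (\sum_(p : pairs D') eps)).
    rewrite big_mkcond ler_sum// => p _; case: ifP => _; last exact: ltW.
    by rewrite mxE; case: asboolP => _; rewrite ?mulr1n// ltW.
  by rewrite sumr_const -[leLHS]mulr_natl ler_pdivrMr ?ltr0n// mul1r ler_nat.
have [||u [uA u_ge0] ub_ge0] := @affine_farkas R _ _ A b (c - f).
- by exists (char_vector R D' a0); exact/feasible/DD'.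
- exact: cf_ge0.
have reducedE p : reduced_cost (c01 R D) A u p =
    c 0 (enum_rank p) - (u *m A) 0 (enum_rank p).
  by rewrite /reduced_cost colE mulmxA -colE [col _ _ _ _]mxE [c _ _]mxE enum_rankK.
have u_feasible : dual_feasible A c u.
  split=> // i j; rewrite !ord1; apply: le_trans (uA 0 j) _.
  by rewrite [leLHS]mxE [X in _ + X]mxE gerBl.
exists u.
  split=> // u' u'_feasible; apply: le_mx_trans ub_ge0 => i j; rewrite !ord1 [leRHS]mxE.
  have := weak_duality u'_feasible (feasible _ (DD' _ Da0)).
  by move=> /(_ 0 0); rewrite (support_cost0 R D' Da0).
move=> p; split=> [pF|].
  (* At an inconsistent pair, [u A <= c - f] leaves a reduced cost of at least [eps]. *)
  rewrite reducedE; have := uA 0 (enum_rank p).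
  rewrite [leRHS]mxE [X in _ + X]mxE [f _ _]mxE enum_rankK asboolT// mulr1n.
  by move=> uAp; lra.
move=> r_gt0 [a Da pa]; move: r_gt0; apply/negP; rewrite -leNgt reducedE.
have [Ax x_ge0] := feasible _ (DD' _ Da).
have uAx := le_mx_trans ub_ge0 (le_mx_mul2l u_ge0 Ax).
(* The reduced costs of the pairs of [a] sum to [c x - u A x], where [c x = 0] and
   [u A x >= u b >= 0]. They are all nonnegative, so the one of [p] is at most this sum. *)
have {uAx} : ((c - u *m A) *m char_vector R D' a) 0 0 <= 0.
  rewrite mulmxBl [leLHS]mxE [X in _ + X]mxE (support_cost0 R D' Da).
  by rewrite sub0r oppr_le0; have := uAx 0 0; rewrite mulmxA [leLHS]mxE.
rewrite mul_char_vector (bigD1 p)//=; apply: le_trans.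
rewrite [X in _ <= X + _]mxE [X in _ <= _ + X + _]mxE lerDl sumr_ge0// => q _.
by rewrite [leRHS]mxE [X in _ + X]mxE subr_ge0; exact: u_feasible.1.
Qed.
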